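(* Let $n\in\mathbb{N}$ and let $0\leq l\leq n-2<r\leq 2n-3$ be integers such that $l+r<2n-2$ and $r-l>n-3$. For integers $e$ and $k\ge 1$ put $$b(e,k)=t\binom{k-1}{e-k}-t\binom{k-1}{r-e-l+2n-1-k}+\binom{k-1}{e-1-k}-\binom{k-1}{r-e-l+2n-k}.$$ Let $A$ be the skew-symmetric $(n-1)\times(n-1)$ matrix whose $(k_1,k_2)$-entry is $$A_{k_1,k_2}=\sum_{1\leq e_1<e_2\leq r+1}\ \det_{1\leq i,j\leq 2}\big(b(e_i,k_j)\big).$$ Let $\mathrm{GF}(t)=\sum_{P}t^{\tau(P)}$, the sum being over all $(0,n,r+2-n,r-l)$-Magog pentagons $P$. If $n$ is odd, then $$\mathrm{GF}(t)=t\cdot \mathrm{Pf}(A).$$ If $n$ is even, then $\mathrm{GF}(t)=t\cdot\mathrm{Pf}(A^* )$, where $A^*$ is the skew-symmetric $n\times n$ matrix whose upper left $(n-1)\times(n-1)$ block is $A$ and whose $n$-th column has entries $$A^*_{j,n}=\sum_{1\leq e_1\leq r+1}b(e_1,j)\qquad (1\le j\le n-1).$$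
   Context: **Magog trapezoids and pentagons.** Consider left-justified triangular arrays whose $j$-th row ($1\le j\le n$) is $a_{j,j},a_{j+1,j},\dots,a_{n,j}$ (left to right, all rows starting in the same leftmost column, so $a_{i+1,j+1}$ is directly below $a_{i,j}$). An $(m,n,k)$-Magog trapezoid is an array of positive integers consisting of the top $k$ rows of this shape, i.e. the $a_{i,j}$ with $1\le j\le k$, $j\le i\le n$, such that rows are weakly increasing ($a_{i,j}\le a_{i+1,j}$), columns are weakly decreasing from top to bottom ($a_{i+1,j+1}\le a_{i,j}$), and $a_{i,1}\le m+i$ for all $1\le i\le n$. South-east diagonals of the shape are counted from top right to bottom left, so $a_{i,j}$ lies on diagonal number $n-i+2j-1$. An $(m,n,k,q)$-Magog pentagon consists of the first $q$ south-east diagonals of an $(m,n,k)$-Magog trapezoid: it is an array of positive integers $a_{i,j}$ indexed by those $(i,j)$ with $1\le j\le k$, $j\le i\le n$ and $n-i+2j-1\le q$, such that the inequalities $a_{i,j}\le a_{i+1,j}$ and $a_{i+1,j+1}\le a_{i,j}$ hold whenever both entries involved are present, and the bound $a_{i,1}\le m+i$ holds whenever $a_{i,1}$ is present. Its statistic is $$\tau(P)=n+\sum_{i=1}^k (a_{n-1,i}-a_{n,i}),$$ where any entry in this formula that is cut off (not present in the pentagon) is taken to be $1$. **Pfaffian.** For a skew-symmetric $2N\times 2N$ matrix $A=(a_{i,j})$, $$\mathrm{Pf}(A)=\frac{1}{2^N N!}\sum_{\sigma\in S_{2N}}\mathrm{sgn}(\sigma)\prod_{i=1}^N a_{\sigma(2i-1),\sigma(2i)}.$$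 **Binomials.** $\binom{a}{b}=0$ if $b<0$ or $b>a$ (here always $a\ge 0$). *)

(* Defs.v *)
From HB Require Import structures.
From mathcomp Require Import all_boot all_order all_fingroup all_algebra.
From mathcomp Require Import zify.

Set Implicit Arguments.
Unset Strict Implicit.
Unset Printing Implicit Defensive.

Import Order.TTheory GRing.Theory Num.Theory.
Local Open Scope ring_scope.

(* Since j <= i <= n and 1 <= j, no truncated subtraction occurs in
   the number of the south-east diagonal of (i, j). *)
Definition in_pentagon (n k q i j : nat) : bool :=
  [&& 1 <= j <= k, j <= i <= n & n - i + 2 * j - 1 <= q]%N.

Definition cell (n k q : nat) : Type :=
  {c : 'I_n.+1 * 'I_k.+1 | in_pentagon n k q c.1 c.2}.

Section Pentagon.
Variables (n k q : nat).
Implicit Types (c d : cell n k q) (a : cell n k q -> nat).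

Definition idx c : nat := (val c).1.
Definition jdx c : nat := (val c).2.

Definition is_magog (m : nat) a : bool :=
  [&& [forall c, 1 <= a c],
      [forall c, forall d,
         (idx d == (idx c).+1) && (jdx d == jdx c) ==> (a c <= a d)],
      [forall c, forall d,
         (idx d == (idx c).+1) && (jdx d == (jdx c).+1) ==> (a d <= a c)]
    & [forall c, (jdx c == 1) ==> (a c <= m + idx c)]]%N.

(* The value 1 stands for the entries that are cut off. *)
Definition entry a (i j : nat) : nat :=
  if [pick c | (idx c == i) && (jdx c == j)] is Some c then a c else 1%N.

Definition tau a : int :=
  n%:Z + \sum_(1 <= i < k.+1) ((entry a n.-1 i)%:Z - (entry a n i)%:Z).

Lemma cellP c : in_pentagon n k q (idx c) (jdx c).
Proof. exact: valP c. Qed.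

Lemma in_cell i j :
  in_pentagon n k q i j -> exists2 c, idx c = i & jdx c = j.
Proof.
move=> h; have /and3P[/andP[_ hj] /andP[_ hi] _] := h.
rewrite -ltnS in hj; rewrite -ltnS in hi.
by exists (exist _ (Ordinal hi, Ordinal hj) h : cell n k q).
Qed.

Lemma cell_inj c d : idx c = idx d -> jdx c = jdx d -> c = d.
Proof.
move=> hi hj; apply: val_inj; rewrite [val c]surjective_pairing.
by rewrite [val d]surjective_pairing; congr pair; apply: val_inj.
Qed.

Lemma entryE a c : entry a (idx c) (jdx c) = a c.
Proof.
rewrite /entry; case: pickP => [d /andP[/eqP hi /eqP hj]|/(_ c)].
  by rewrite (cell_inj hi hj).
by rewrite !eqxx.
Qed.

Lemma entry_out a i j : ~~ in_pentagon n k q i j -> entry a i j = 1%N.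
Proof.
move=> h; rewrite /entry; case: pickP => // c /andP[/eqP hi /eqP hj].
by move: h; rewrite -hi -hj cellP.
Qed.

Lemma entry_gt0 m a i j : is_magog m a -> (0 < entry a i j)%N.
Proof.
case/and4P=> /forallP h _ _ _; rewrite /entry.
by case: pickP => // c _; apply: h.
Qed.

(* All entries of a pentagon are at most m + n, so that there are finitely
   many pentagons. *)
Lemma magog_le m a c : is_magog m a -> (a c <= m + n)%N.
Proof.
case/and4P=> _ _ /forallP hc /forallP hb.
move ej: (jdx c) => j; elim: j c ej => [|[|j] IH] c ej.
- by have := cellP c; rewrite ej /in_pentagon.
- have := hb c; rewrite ej /= => /leq_trans; apply.
  by have := cellP c; rewrite /in_pentagon; lia.
have [|d hi hj] := @in_cell (idx c).-1 j.+1.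
- by have := cellP c; rewrite /in_pentagon ej; lia.
have /forallP/(_ c) := hc d; rewrite hi hj ej eqxx andbT.
have -> : idx c == (idx c).-1.+1.
  by have := cellP c; rewrite /in_pentagon ej; lia.
by move=> /= /leq_trans; apply; apply: IH.
Qed.

End Pentagon.

(* The exponents are positive, so integer powers of 'X in {poly rat} are
   ordinary powers here. *)
Lemma tau_gt0 n k q (a : cell n k q -> nat) :
  (0 < k < n)%N -> is_magog 0 a -> 0 < tau a.
Proof.
move=> /andP[k0 kn] ha; have n0 : (0 < n)%N by lia.
case/and4P: (ha) => _ _ /forallP hc /forallP hb.
have h1 : (entry a n 1 <= n)%N.
  case: (boolP (in_pentagon n k q n 1)) => [/in_cell[c hi hj]|/entry_out->//].
  by have := hb c; have := entryE a c; rewrite hi hj => ->; rewrite eqxx.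
have h2 i : (1 <= i)%N -> (entry a n i.+1 <= entry a n.-1 i)%N.
  move=> i1; case: (boolP (in_pentagon n k q n i.+1)) => [h|/entry_out->];
    last exact: entry_gt0 ha.
  have [c hi hj] := in_cell h.
  have [|d hi' hj'] := @in_cell n k q n.-1 i.
    by move: h; rewrite /in_pentagon; lia.
  have /forallP/(_ c) := hc d.
  have := entryE a c; have := entryE a d; rewrite hi hj hi' hj' => -> ->.
  by rewrite prednK // !eqxx.
case: k k0 kn a ha hb hc h1 h2 => // k _ kn a ha hb hc h1 h2; rewrite /tau.
rewrite sumrB [X in _ + (X - _)]big_nat_recr //= [X in _ + (_ - X)]big_nat_recl //.
have hs : \sum_(1 <= i < k.+1) (entry a n i.+1)%:Z
   <= \sum_(1 <= i < k.+1) (entry a n.-1 i)%:Z :> int.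
  by rewrite big_nat_cond [leRHS]big_nat_cond; apply: ler_sum => i; have := h2 i; lia.
have key (s u : int) (x y : nat) : (x <= n)%N -> s <= u -> (0 < y)%N ->
    0 < n%:Z + (u + y%:Z - (x%:Z + s)) by lia.
by apply: key; [exact: h1 | exact: hs | exact: entry_gt0 ha].
Qed.

(* By magog_le, the entries of all pentagons lie in 'I_(m + n).+1. *)
Definition GF (m n k q : nat) : {poly rat} :=
  \sum_(P : {ffun cell n k q -> 'I_(m + n).+1} | is_magog m (fun c => P c : nat))
    'X ^ tau (fun c => P c : nat).

Lemma ltn_double_half m (i : 'I_m./2) : (i.*2 < m)%N.
Proof. by have := ltn_ord i; lia. Qed.

Lemma ltn_doubleS_half m (i : 'I_m./2) : (i.*2.+1 < m)%N.
Proof. by have := ltn_ord i; lia. Qed.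

(* Meaningful for even m, with N = m./2, in rings where 2 ^ N * N`! is a unit. *)
Definition Pf (R : comUnitRingType) (m : nat) (A : 'M[R]_m) : R :=
  ((2 ^ m./2 * (m./2)`!)%N%:R)^-1 *
  \sum_(s : 'S_m) (-1) ^+ s *
    \prod_(i < m./2)
      A (s (Ordinal (ltn_double_half i))) (s (Ordinal (ltn_doubleS_half i))).

Definition zbinom (a : nat) (b : int) : nat :=
  if b is Posz c then 'C(a, c) else 0%N.

Definition bcoef (n l r : nat) (e : int) (k : nat) : {poly rat} :=
  'X * (zbinom k.-1 (e - k%:Z))%:R
  - 'X * (zbinom k.-1 (r%:Z - e - l%:Z + 2 * n%:Z - 1 - k%:Z))%:R
  + (zbinom k.-1 (e - 1 - k%:Z))%:R
  - (zbinom k.-1 (r%:Z - e - l%:Z + 2 * n%:Z - k%:Z))%:R.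

(* Ordinals start at 0, whence the successors of matrix indices. *)
Definition Amx (n l r : nat) : 'M[{poly rat}]_n.-1 :=
  \matrix_(k1, k2)
    \sum_(1 <= e1 < r.+2) \sum_(e1.+1 <= e2 < r.+2)
      \det (\matrix_(i < 2, j < 2)
              bcoef n l r (tnth [tuple e1; e2] i)%:Z (tnth [tuple k1.+1; k2.+1] j)).

Definition lastcol (n l r : nat) : 'cV[{poly rat}]_n.-1 :=
  \col_j \sum_(1 <= e1 < r.+2) bcoef n l r e1%:Z j.+1.

Definition Astar (n l r : nat) : 'M[{poly rat}]_(n.-1 + 1) :=
  block_mx (Amx n l r) (lastcol n l r) (- (lastcol n l r)^T) 0.

(* Main.v *)
Require Import Defs.
From mathcomp Require Import all_boot all_order all_fingroup all_algebra.
From mathcomp Require Import zify ring.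
Import Order.TTheory GRing.Theory Num.Theory.
Set Implicit Arguments.
Unset Strict Implicit.
Unset Printing Implicit Defensive.
Local Open Scope ring_scope.

(* On the antidiagonal i = t + 1 of a pentagon, record for each v >= 2 the
   number s_v(t) of entries that are >= v.  The Magog inequalities say that the
   s_v are weakly decreasing in v and that each of them grows by 0 or 1 when t
   grows by 1; the shape of the pentagon becomes an upper bound on s_2 alone,
   and tau counts the s_v that stay constant in the last step.  After the shift
   s_v + t - v + 2 this is a system of strictly ordered particles with steps 1
   and 2, below a wall, one new particle entering at each unit of time.
   The number of ways to reach a configuration is a determinant of one-particle
   path counts, corrected for the wall by the reflection principle: expanding
   the rows of the determinant by Pascal's rule sums over all the possible last
   steps, and the forbidden ones yield vanishing determinants, since particles
   with steps 1 and 2 cannot overtake each other without having met.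
   Finally, the sum of these determinants over all end configurations is
   a Pfaffian by the minor-summation formula; in the odd-dimensional case a row
   and a column are added to the matrix whose minors are summed. *)

(** * Minor summation *)

Notation even_ord i := (Ordinal (ltn_double_half i)).
Notation odd_ord i := (Ordinal (ltn_doubleS_half i)).

Lemma half_ltn_even m (i : 'I_m) : ~~ odd m -> (i./2 < m./2)%N.
Proof. by have := ltn_ord i; lia. Qed.

Section Pfaffian.
Variable R : comNzRingType.

(** The Pfaffian without its normalising factor, so that the summation argument needs no
    division. *)
Definition pfsum m (A : 'I_m -> 'I_m -> R) : R :=
  \sum_(s : 'S_m) (-1) ^+ s * \prod_(i < m./2) A (s (even_ord i)) (s (odd_ord i)).

(** The skew-symmetric sign kernel; its Pfaffian is 1 in every even order, which makes it the right
    weight for pairs of rows. *)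
Definition sgl (x y : nat) : R := (x < y)%N%:R - (y < x)%N%:R.

(** Strictly increasing maps encode the choices of [m] rows among [p]. *)
Definition sincr m p (f : {ffun 'I_m -> 'I_p}) : bool :=
  [forall i : 'I_m, forall j : 'I_m, (i < j)%N ==> (f i < f j)%N].

Lemma sincrP m p (f : {ffun 'I_m -> 'I_p}) :
  reflect (forall i j : 'I_m, (i < j)%N -> (f i < f j)%N) (sincr f).
Proof.
apply: (iffP forallP) => [h i j|h i].
  by have /forallP/(_ j)/implyP := h i.
by apply/forallP=> j; apply/implyP/h.
Qed.

Lemma sincr_ltn m p (f : {ffun 'I_m -> 'I_p}) (i j : 'I_m) :
  sincr f -> (f i < f j)%N = (i < j)%N.
Proof.
move=> /sincrP h; case: (ltngtP i j) => [/h->//|/h|/val_inj->]; last exact: ltnn.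
by case: ltngtP.
Qed.

Lemma sincr_inj m p (f : {ffun 'I_m -> 'I_p}) : sincr f -> injective f.
Proof.
move=> hf i j e; apply: val_inj; have := sincr_ltn i j hf.
by have := sincr_ltn j i hf; rewrite e ltnn; case: (ltngtP (i : nat) j).
Qed.

Lemma prod_pairs m (F : 'I_m -> R) : ~~ odd m ->
  \prod_(j < m) F j = \prod_(i < m./2) (F (even_ord i) * F (odd_ord i)).
Proof.
(* Extending [F] by 1 to all of [nat] permits induction on the number of pairs. *)
move=> em; pose G k := if insub k is Some j then F j else 1.
have GE (j : 'I_m) : F j = G j by rewrite /G valK.
rewrite (eq_bigr _ (fun j _ => GE j)).
under [RHS]eq_bigr do rewrite !GE /=.
have -> : \prod_(j < m) G j = \prod_(j < m./2.*2) G j.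
  by rewrite even_halfK.
elim: (m./2) => [|N IH]; first by rewrite !big_ord0.
by rewrite doubleS !big_ord_recr /= IH mulrA.
Qed.

(** Distributivity picks one pair of values for each [i], and the pairs interleave to a single
    function on ['I_m]. *)
Lemma prod_sum_pairs m (I : finType) (H : 'I_m./2 -> I -> I -> R) : ~~ odd m ->
  \prod_(i < m./2) (\sum_e \sum_f H i e f) =
  \sum_(f : {ffun 'I_m -> I}) \prod_(i < m./2) H i (f (even_ord i)) (f (odd_ord i)).
Proof.
move=> em; under eq_bigr do rewrite pair_bigA /=.
rewrite (bigA_distr_bigA (fun i p => H i p.1 p.2)) /=.
pose hf (f : {ffun 'I_m -> I}) := [ffun i : 'I_m./2 => (f (even_ord i), f (odd_ord i))].
pose kf (g : {ffun 'I_m./2 -> I * I}) := [ffun j : 'I_m =>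
  let p := g (Ordinal (half_ltn_even j em)) in if odd j then p.2 else p.1].
rewrite (reindex hf) /=; last first.
  exists kf => f _; apply/ffunP => j; rewrite !ffunE /=.
    by case: ifP => hj; congr (f _); apply: val_inj; rewrite /=; lia.
  rewrite odd_double /= [RHS]surjective_pairing.
  by congr ((f _).1, (f _).2); apply: val_inj; rewrite /=; lia.
by apply: eq_bigr => f _; apply: eq_bigr => i _; rewrite ffunE.
Qed.

Lemma rank_perm_exists m p (f : {ffun 'I_m -> 'I_p}) : injective f ->
  exists s : 'S_m, forall i, s i = #|[set j | (f j < f i)%N]| :> nat.
Proof.
move=> fi.
have sub i j : (f i < f j)%N ->
    (#|[set k | (f k < f i)%N]| < #|[set k | (f k < f j)%N]|)%N.
  move=> lij; apply/proper_card/properP; split.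
    by apply/subsetP => k; rewrite !inE => /ltn_trans; apply.
  by exists i; rewrite !inE ?ltnn.
have lt i : (#|[set j | (f j < f i)%N]| < m)%N.
  rewrite -[X in (_ < X)%N]card_ord -cardsT; apply/proper_card/properP.
  by split; [apply/subsetP => k; rewrite inE | exists i; rewrite !inE ?ltnn].
have inj : injective (fun i => Ordinal (lt i)).
  move=> i j /(congr1 val) /= e; apply/fi/val_inj.
  by case: (ltngtP (f i) (f j)) => // /sub; rewrite e ltnn.
by exists (perm inj) => i; rewrite permE.
Qed.

(** An injective map is, in a unique way, an increasing map after a permutation: the permutation of
    the ranks of its values. *)
Lemma sum_inj_sincr m p (phi : {ffun 'I_m -> 'I_p} -> R) :
  (forall f : {ffun 'I_m -> 'I_p}, ~~ injectiveb f -> phi f = 0) ->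
  \sum_f phi f =
  \sum_(h | sincr h) \sum_(s : 'S_m) phi [ffun i => h (s i)].
Proof.
move=> phi0; rewrite (bigID (fun f : {ffun 'I_m -> 'I_p} => injectiveb f)) /= [X in _ + X]big1 // addr0.
rewrite pair_big_dep /=.
(* The default [1%g] is reached only by maps that are not injective. *)
pose rk (f : {ffun 'I_m -> 'I_p}) : 'S_m :=
  odflt 1%g [pick s : 'S_m | [forall i, s i == #|[set j | (f j < f i)%N]| :> nat]].
have rkE (f : {ffun 'I_m -> 'I_p}) i : injectiveb f ->
    rk f i = #|[set j | (f j < f i)%N]| :> nat.
  move=> /injectiveP/rank_perm_exists[s hs]; rewrite /rk; case: pickP => [t|/(_ s)].
    by move/forallP/(_ i)/eqP.
  by move=> /negbT/negP[]; apply/forallP=> k; rewrite hs.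
have rk_lt (f : {ffun 'I_m -> 'I_p}) i j : injectiveb f -> (f i < f j)%N -> (rk f i < rk f j)%N.
  move=> fi lij; rewrite !rkE //; apply/proper_card/properP; split.
    by apply/subsetP => k; rewrite !inE => /ltn_trans; apply.
  by exists i; rewrite !inE ?ltnn.
rewrite (reindex_onto (fun q : {ffun 'I_m -> 'I_p} * 'S_m => [ffun i => q.1 (q.2 i)])
   (fun f => ([ffun i => f ((rk f)^-1%g i)], rk f))) /=; last first.
  by move=> f _; apply/ffunP=> i; rewrite !ffunE permK.
apply: eq_bigl => -[h s] /=; apply/andP/andP => [[fi]|[hh _]].
  set f := finfun _ in fi *; move=> /eqP [<- rf].
  split=> //; apply/sincrP => i j lij; rewrite [finfun _ i]ffunE [finfun _ j]ffunE.
  rewrite -[i](permKV (rk f)) -[j](permKV (rk f)) in lij.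
  case: (ltngtP (f ((rk f)^-1%g i)) (f ((rk f)^-1%g j))) => //.
    by move/(rk_lt _ _ _ fi); case: ltngtP lij.
  by move/val_inj/(injectiveP _ fi) => e; move: lij; rewrite e ltnn.
have fi : injectiveb [ffun i => h (s i)].
  by apply/injectiveP => i j; rewrite !ffunE => /(sincr_inj hh)/perm_inj.
split=> //; set f := finfun _ in fi *.
have rs : rk f = s.
  apply/permP => i; apply: val_inj; rewrite /= rkE //.
  transitivity #|[set z : 'I_m | (z < s i)%N]|; last first.
    rewrite -sum1_card (eq_bigl (fun z : 'I_m => z < s i)%N) => [|z]; last by rewrite inE.
    rewrite -(big_ord_widen m (fun=> 1%N) (ltnW (ltn_ord (s i)))).
    by rewrite sum1_card card_ord.
  rewrite -[RHS](card_preimset _ (@perm_inj _ s)).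
  by apply: eq_card => j; rewrite !inE !ffunE sincr_ltn.
rewrite rs; apply/eqP; congr pair; apply/ffunP => i.
by rewrite !ffunE permKV.
Qed.

(** A permutation is determined by the image of 0 and the permutation induced on the remaining
    points; counting shows that every pair occurs. *)
Lemma sum_lift_perm n (F : 'S_n.+1 -> R) :
  \sum_s F s = \sum_(j < n.+1) \sum_(t : 'S_n) F (lift_perm ord0 j t).
Proof.
rewrite pair_bigA /= (reindex (fun q : 'I_n.+1 * 'S_n => lift_perm ord0 q.1 q.2)) //.
apply: onW_bij; apply: inj_card_bij => [[j t] [k u] /= e|].
  have ejk : j = k by rewrite -(lift_perm_id ord0 j t) e lift_perm_id.
  congr pair => //; apply/permP => i; apply: (@lift_inj _ j).
  by rewrite -(lift_perm_lift ord0) e -ejk lift_perm_lift.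
by rewrite card_prod !card_Sn card_ord factS.
Qed.

Lemma sgl_lift n (h : 'I_n.+1) (i j : 'I_n) : sgl (lift h i) (lift h j) = sgl i j.
Proof.
have e (a b : 'I_n) : (lift h a < lift h b)%N = (a < b)%N.
  by rewrite /= /bump; case: leqP; case: leqP; lia.
by rewrite /sgl !e.
Qed.

Lemma sum_sign n : \sum_(i < n) (-1) ^+ i = (odd n)%:R :> R.
Proof.
elim: n => [|n IH]; first by rewrite big_ord0.
rewrite big_ord_recr IH /= -signr_odd; case: (odd n); rewrite ?expr1 ?expr0 /=.
  by rewrite subrr.
by rewrite add0r.
Qed.

(** Indices below [x] count negatively, so the sum is the full alternating sum minus twice its part
    below [x], that is 1 - 2 * odd x. *)
Lemma sum_sign_sgl n (x : 'I_n.+1) : odd n ->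
  \sum_(y < n) (-1) ^+ y * sgl x (lift x y) = (-1) ^+ x.
Proof.
move=> on.
transitivity (\sum_(y < n) (-1) ^+ y - (\sum_(y < n | (y < x)%N) (-1) ^+ y) *+ 2 : R).
  rewrite [X in _ - X *+ 2]big_mkcond /= -sumrMnl -sumrB; apply: eq_bigr => y _.
  rewrite /sgl /= /bump; case: (leqP x y) => hxy /=.
    have -> : (x < 1 + y)%N by lia.
    have -> : (1 + y < x)%N = false by lia.
    by rewrite mul0rn !subr0 mulr1.
  rewrite add0n hxy; have -> : (x < y)%N = false by lia.
  by rewrite sub0r mulrN1 mulr2n opprD addrA subrr sub0r.
have le_xn : (x <= n)%N by rewrite -ltnS.
rewrite -(big_ord_widen n (fun y => (-1) ^+ y : R) le_xn) !sum_sign on -[RHS]signr_odd.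
by case: (odd x); rewrite ?expr1 ?expr0 /= ; ring.
Qed.

(** Let 0 go to [x] and 1 to [lift x y]. The sum over [y] is (-1)^x by [sum_sign_sgl] and cancels
    the sign due to [x], so all m + 2 choices of [x] contribute equally. *)
Lemma pfsum_sgl_rec m : ~~ odd m ->
  pfsum (fun i j : 'I_m.+2 => sgl i j) = m.+2%:R * pfsum (fun i j : 'I_m => sgl i j).
Proof.
move=> em; rewrite /pfsum sum_lift_perm.
have perm5 (a b c d e : R) : a * (b * c) * (d * e) = b * d * (a * (c * e)) by ring.
have inner (x : 'I_m.+2) : \sum_(t : 'S_m.+1) (-1) ^+ lift_perm ord0 x t *
   \prod_(i < m.+2./2)
     sgl (lift_perm ord0 x t (even_ord i)) (lift_perm ord0 x t (odd_ord i)) =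
   \sum_(t : 'S_m) (-1) ^+ t *
     \prod_(i < m./2) sgl (t (even_ord i)) (t (odd_ord i)).
  rewrite sum_lift_perm exchange_big /=; apply: eq_bigr => t _.
  have termE (y : 'I_m.+1) : (-1) ^+ lift_perm ord0 x (lift_perm ord0 y t) *
     \prod_(i < (m./2).+1)
       sgl (lift_perm ord0 x (lift_perm ord0 y t) (even_ord (i : 'I_m.+2./2)))
           (lift_perm ord0 x (lift_perm ord0 y t) (odd_ord (i : 'I_m.+2./2))) =
     ((-1) ^+ y * sgl x (lift x y)) * ((-1) ^+ x * ((-1) ^+ t *
     \prod_(i < m./2) sgl (t (even_ord i)) (t (odd_ord i)))).
    rewrite big_ord_recl.
    have -> : even_ord (ord0 : 'I_m.+2./2) = ord0 by apply: val_inj.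
    have -> : odd_ord (ord0 : 'I_m.+2./2) = lift ord0 ord0 by apply: val_inj.
    rewrite lift_perm_lift !lift_perm_id !odd_lift_perm /= !signr_addb !signr_odd.
    rewrite (eq_bigr (fun i => sgl (t (even_ord i)) (t (odd_ord i)))) => [|i _].
      exact: (perm5 ((-1) ^+ x) ((-1) ^+ y)).
    have -> : even_ord (lift ord0 i : 'I_m.+2./2) = lift ord0 (lift ord0 (even_ord i)).
      by apply: val_inj.
    have -> : odd_ord (lift ord0 i : 'I_m.+2./2) = lift ord0 (lift ord0 (odd_ord i)).
      by apply: val_inj.
    by rewrite !lift_perm_lift !sgl_lift.
  rewrite (eq_bigr _ (fun y _ => termE y)) -big_distrl /= sum_sign_sgl //.
  by rewrite mulrA -exprD addnn -muln2 exprM sqrr_sign mul1r.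
by rewrite (eq_bigr _ (fun x _ => inner x)) sumr_const card_ord mulr_natl.
Qed.

Lemma pfsum_sgl m : ~~ odd m ->
  pfsum (fun i j : 'I_m => sgl i j) = (2 ^ m./2 * (m./2)`!)%N%:R.
Proof.
move=> em; rewrite -(even_halfK em) doubleK.
elim: (m./2) => [|N IH].
  rewrite /pfsum (eq_bigr (fun=> 1)) => [|s _].
    by rewrite sumr_const card_Sn.
  rewrite big_ord0 mulr1; have -> : s = 1%g by apply/permP => -[].
  by rewrite odd_perm1.
rewrite doubleS pfsum_sgl_rec ?odd_double // IH -natrM; congr (_%:R).
by rewrite factS expnS; lia.
Qed.

Definition minor_pair p (B : 'I_p -> nat -> R) (j k : nat) : R :=
  \sum_(e < p) \sum_(f < p | (e < f)%N) (B e j * B f k - B e k * B f j).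

(** Exchanging [e] and [f] in the negative half of the kernel turns the pair minors into the
    congruence B^T S B with S = [sgl]. *)
Lemma minor_pairE p (B : 'I_p -> nat -> R) j k :
  minor_pair B j k = \sum_(e < p) \sum_(f < p) sgl e f * (B e j * B f k).
Proof.
rewrite /minor_pair.
have -> : \sum_(e < p) \sum_(f < p) sgl e f * (B e j * B f k) =
    \sum_(e < p) \sum_(f < p) (e < f)%N%:R * (B e j * B f k)
    - \sum_(e < p) \sum_(f < p) (f < e)%N%:R * (B e j * B f k).
  rewrite -sumrB; apply: eq_bigr => e _; rewrite -sumrB.
  by apply: eq_bigr => f _; rewrite -mulrBl.
rewrite [X in _ - X]exchange_big -sumrB; apply: eq_bigr => e _.
rewrite -sumrB big_mkcond; apply: eq_bigr => f _.
by case: ltnP => _; rewrite ?mul1r ?mul0r ?subr0 // [B f j * _]mulrC.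
Qed.

(* The minor-summation formula of Ishikawa and Wakayama, before normalisation. *)
Lemma pfsum_minor m p (B : 'I_p -> nat -> R) : ~~ odd m ->
  pfsum (fun i j : 'I_m => minor_pair B i j) =
  (2 ^ m./2 * (m./2)`!)%N%:R *
  \sum_(f : {ffun 'I_m -> 'I_p} | sincr f) \det (\matrix_(i, j) B (f i) j).
Proof.
move=> em; pose w (f : {ffun 'I_m -> 'I_p}) :=
  \prod_(i < m./2) sgl (f (even_ord i)) (f (odd_ord i)).
(* Expanding all factors chooses a row for each index; the sum over permutations of the columns then
   assembles a determinant. *)
have -> : pfsum (fun i j : 'I_m => minor_pair B i j) =
    \sum_(f : {ffun 'I_m -> 'I_p}) w f * \det (\matrix_(i, j) B (f i) j).
  rewrite /pfsum; under [RHS]eq_bigr do rewrite /determinant big_distrr.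
  rewrite exchange_big /=; apply: eq_bigr => s _.
  under eq_bigr do rewrite minor_pairE.
  rewrite (prod_sum_pairs (fun i (e f : 'I_p) =>
    sgl e f * (B e (s (even_ord i)) * B f (s (odd_ord i))))) //.
  rewrite big_distrr; apply: eq_bigr => f _.
  rewrite big_split /= -/(w f) mulrCA; congr (_ * (_ * _)).
  rewrite -(prod_pairs (fun i => B (f i) (s i))) //.
  by apply: eq_bigr => i _; rewrite mxE.
(* A repeated value gives two equal rows, so only reorderings of increasing maps remain. *)
rewrite sum_inj_sincr => [|f /injectivePn[i [j neq_ij eq_f]]]; last first.
  rewrite (determinant_alternate neq_ij) ?mulr0 // => k.
  by rewrite !mxE eq_f.
rewrite big_distrr; apply: eq_bigr => h hh /=; rewrite -pfsum_sgl // big_distrl /=.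
apply: eq_bigr => s _.
have -> : \matrix_(i, j) B ([ffun i => h (s i)] i) j =
    row_perm s (\matrix_(i < m, j < m) B (h i) j).
  by apply/matrixP => i j; rewrite !mxE ffunE.
(* The signs of the row permutations turn the weights [w] into the unnormalised Pfaffian of the sign
   kernel. *)
rewrite row_permE det_mulmx det_perm mulrA [w _ * _]mulrC; congr (_ * _ * _).
by apply: eq_bigr => i _; rewrite !ffunE /sgl !sincr_ltn.
Qed.

End Pfaffian.

Lemma Pf_minor (R : comUnitRingType) m p (B : 'I_p -> nat -> R) (A : 'M[R]_m) :
  ~~ odd m -> (2 ^ m./2 * (m./2)`!)%N%:R \is a @GRing.unit R ->
  (forall i j, A i j = minor_pair B i j) ->
  Pf A = \sum_(f : {ffun 'I_m -> 'I_p} | sincr f) \det (\matrix_(i, j) B (f i) j).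
Proof.
move=> em u AE; rewrite -[RHS](mulKr u) -pfsum_minor // /Pf; congr (_ * _).
by apply: eq_bigr => s _; congr (_ * _); apply: eq_bigr => i _; rewrite AE.
Qed.

(** A row and a column are added that vanish except for a 1 where they meet; this makes an odd order
    even. *)
Definition border (R : pzRingType) (p m : nat) (B : nat -> nat -> R) (e k : nat) : R :=
  if (e < p)%N then if (k < m)%N then B e k else 0 else (k == m)%:R.

(** A minor without the added row has a zero last column. Otherwise that row, having the largest
    index, comes last, and the minor is block diagonal with corner 1. *)
Lemma sum_sincr_border (R : comUnitRingType) p m (B : nat -> nat -> R) :
  \sum_(f : {ffun 'I_(m + 1) -> 'I_p.+2} | sincr f)
     \det (\matrix_(i, j) border p.+1 m B (f i) j) =
  \sum_(f : {ffun 'I_m -> 'I_p.+1} | sincr f) \det (\matrix_(i, j) B (f i) j).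
Proof.
pose lst : 'I_(m + 1) := rshift m ord0.
rewrite (bigID (fun f : {ffun 'I_(m + 1) -> 'I_p.+2} => f lst == ord_max)) /=.
rewrite [X in _ + X]big1 ?addr0 => [|f /andP[/sincrP hf fl]]; last first.
  have fp i : (f i < p.+1)%N.
    have : (f lst < p.+1)%N.
      by have := ltn_ord (f lst); rewrite ltnS leq_eqVlt; case/orP => // e;
        case/negP: fl; apply/eqP/val_inj/eqP; rewrite -eqSS.
    case: (ltngtP i lst) => [/hf/ltn_trans|hi|/val_inj->//]; first exact.
    by have := ltn_ord i; move: hi => /=; lia.
  rewrite (expand_det_col _ lst) big1 // => i _.
  by rewrite !mxE /border fp /= addn0 ltnn mul0r.
pose h (g : {ffun 'I_m -> 'I_p.+1}) : {ffun 'I_(m + 1) -> 'I_p.+2} :=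
  [ffun i => if split i is inl i' then widen_ord (leqnSn _) (g i') else ord_max].
pose h' (f : {ffun 'I_(m + 1) -> 'I_p.+2}) : {ffun 'I_m -> 'I_p.+1} :=
  [ffun i => inord (f (lshift 1 i))].
have hl g i : h g (lshift 1 i) = g i :> nat.
  by rewrite ffunE (unsplitK (inl _ _)).
have hr g i : h g (rshift m i) = ord_max by rewrite ffunE (unsplitK (inr _ _)).
rewrite (reindex_onto h h') /=; last first.
  move=> f /andP[/sincrP hf /eqP fl]; apply/ffunP => i; apply: val_inj.
  rewrite -(splitK i); case: (split i) => i' /=; last by rewrite ord1 hr fl.
  rewrite hl ffunE inordK //.
  have /= := hf (lshift 1 i') lst; rewrite fl addn0; apply; exact: ltn_ord.
apply: eq_big => [g|g _].
  have -> : h' (h g) == g.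
    by apply/eqP/ffunP => i; apply: val_inj; rewrite ffunE /= hl inordK.
  rewrite hr eqxx !andbT; apply/sincrP/sincrP => hg i j lij.
    by have := hg (lshift 1 i) (lshift 1 j) lij; rewrite !hl.
  move: lij; rewrite -(splitK i) -(splitK j).
  case: (split i) => i'; case: (split j) => j' /=.
  - by rewrite !hl; apply: hg.
  - by rewrite hr hl ltn_ord.
  - by have := ltn_ord j'; lia.
  by rewrite !ord1 ltnn.
have -> : \matrix_(i < m + 1, j < m + 1) border p.+1 m B (h g i) j =
    block_mx (\matrix_(i < m, j < m) B (g i) j) 0 0 1%:M.
  apply/matrixP => i j; rewrite -(splitK i) -(splitK j) mxE.
  case: (split i) => i'; case: (split j) => j' /=.
  - by rewrite block_mxEul hl /border !ltn_ord mxE.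
  - by rewrite block_mxEur hl /border !ltn_ord ord1 addn0 ltnn mxE.
  - by rewrite block_mxEdl hr /border /= ltnn mxE; have := ltn_ord j'; case: eqP => //; lia.
  by rewrite block_mxEdr hr /border /= ltnn !ord1 addn0 !eqxx mxE eqxx.
by rewrite det_ublock det1 mulr1.
Qed.

(** The pairs formed with the added row contribute the column sums of [B], hence the border [c]; the
    other pairs give [A]. *)
Lemma Pf_minor_border (R : comUnitRingType) m p (B : nat -> nat -> R)
    (A : 'M[R]_m) (c : 'cV[R]_m) :
  odd m -> (2 ^ (m + 1)./2 * ((m + 1)./2)`!)%N%:R \is a @GRing.unit R ->
  (forall i j, A i j = minor_pair (fun e : 'I_p.+1 => B e) i j) ->
  (forall i, c i ord0 = \sum_(e < p.+1) B e i) ->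
  Pf (block_mx A c (- c^T) 0) =
  \sum_(f : {ffun 'I_m -> 'I_p.+1} | sincr f) \det (\matrix_(i, j) B (f i) j).
Proof.
move=> om u AE cE; rewrite -sum_sincr_border.
apply: (Pf_minor (B := fun e : 'I_p.+2 => border p.+1 m B e)) => //.
  by rewrite addn1 /= om.
have bl (e : 'I_p.+1) (j : 'I_m) : border p.+1 m B e j = B e j.
  by rewrite /border !ltn_ord.
have bm (j : 'I_m) : border p.+1 m B p.+1 j = 0.
  by rewrite /border ltnn; have := ltn_ord j; case: eqP => //; lia.
have br (e : 'I_p.+1) : border p.+1 m B e m = 0 by rewrite /border ltn_ord ltnn.
have bc : border p.+1 m B p.+1 m = 1 by rewrite /border ltnn eqxx.
(* The added row has the largest index, so it occurs only as the second member of a pair. *)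
have mpE i j : minor_pair (fun e : 'I_p.+2 => border p.+1 m B e) i j =
    minor_pair (fun e : 'I_p.+1 => border p.+1 m B e) i j +
    \sum_(e < p.+1) (border p.+1 m B e i * border p.+1 m B p.+1 j
                  - border p.+1 m B e j * border p.+1 m B p.+1 i).
  rewrite /minor_pair big_ord_recr /= [X in _ + X]big1 ?addr0 => [|f].
    rewrite -big_split /=; apply: eq_bigr => e _.
    rewrite big_mkcond big_ord_recr /= -big_mkcond /= ltn_ord.
    by congr (_ + _); apply: eq_bigl => f.
  by have := ltn_ord f; lia.
move=> i j; rewrite mpE -(splitK i) -(splitK j).
case: (split i) => i'; case: (split j) => j' /=.
- rewrite block_mxEul AE [X in _ + X]big1 ?addr0 => [|e _]; last by rewrite !bm !mulr0 subrr.
  by apply: eq_bigr => e _; apply: eq_bigr => f _; rewrite !bl.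
- rewrite block_mxEur ord1 addn0 cE [minor_pair _ _ _]big1 ?add0r => [|e _].
    by apply: eq_bigr => e _; rewrite bl bc bm mulr1 mulr0 subr0.
  by rewrite big1 // => f _; rewrite !br mulr0 mul0r subr0.
- rewrite block_mxEdl ord1 addn0 !mxE cE [minor_pair _ _ _]big1 ?add0r => [|e _].
    by rewrite -sumrN; apply: eq_bigr => e _; rewrite bl bc bm mulr1 mulr0 sub0r.
  by rewrite big1 // => f _; rewrite !br mulr0 mul0r subr0.
rewrite block_mxEdr !ord1 addn0 mxE [minor_pair _ _ _]big1 ?add0r => [|e _].
  by rewrite big1 // => e _; rewrite subrr.
by rewrite big1 // => f _; rewrite !br mulr0 subr0.
Qed.

(** * Determinants of reflected path counts *)

Lemma det_sum_rows (R : comNzRingType) n (T : finType) (c : T -> R)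
    (v : T -> 'I_n -> 'I_n -> R) :
  \det (\matrix_(i, j) \sum_x c x * v x i j) =
  \sum_(f : {ffun 'I_n -> T}) \prod_i c (f i) * \det (\matrix_(i, j) v (f i) i j).
Proof.
rewrite /determinant; under [RHS]eq_bigr do rewrite big_distrr.
rewrite exchange_big /=; apply: eq_bigr => s _.
under eq_bigr do rewrite mxE.
rewrite (bigA_distr_bigA (fun i x => c x * v x i (s i))) big_distrr.
apply: eq_bigr => f _; rewrite big_split mulrCA; congr (_ * (_ * _)).
by apply: eq_bigr => i _; rewrite mxE.
Qed.

Lemma det_row0 (R : comNzRingType) n (A : 'M[R]_n) i :
  (forall j, A i j = 0) -> \det A = 0.
Proof. by move=> Ai; rewrite (expand_det_row A i) big1 // => j _; rewrite Ai mul0r. Qed.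

Lemma zbinomS k x : zbinom k.+1 (x + 1) = (zbinom k (x + 1) + zbinom k x)%N.
Proof.
case: x => [x|[|x]]; first by rewrite -PoszD addn1 /= binS.
  by rewrite addn0 /= !bin0.
by have -> : Negz x.+1 + 1 = Negz x by lia.
Qed.

Lemma zbinom_neg k x : x < 0 -> zbinom k x = 0%N.
Proof. by case: x. Qed.

Lemma zbinom_big k x : k%:Z < x -> zbinom k x = 0%N.
Proof. by case: x => // x h; apply: bin_small; lia. Qed.

Section ReflectedPaths.
Variable R : comNzRingType.
Variable Q : nat.

(* Signed count of the [k]-step paths with steps 1 and 2 from 0 to [p], by the
   reflection principle: the factor 3 is there because the wall moves by 3/2
   per unit of time [N]. *)
Definition refl_paths (N k : nat) (p : int) : R :=
  (zbinom k (p - k%:Z))%:R - (zbinom k (Q%:Z + 3 * N%:Z - p - k%:Z))%:R.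

(** Pascal's rule splits by the last step. The reflection constant grows by 3, so steps 1 and 2
    exchange their roles for the reflected endpoint. *)
Lemma refl_pathsS N k p :
  refl_paths N.+1 k.+1 p = refl_paths N k (p - 1) + refl_paths N k (p - 2).
Proof.
rewrite /refl_paths.
have -> : p - k.+1%:Z = p - 2 - k%:Z + 1 by lia.
have -> : p - 1 - k%:Z = p - 2 - k%:Z + 1 by lia.
have -> : Q%:Z + 3 * N.+1%:Z - p - k.+1%:Z = Q%:Z + 3 * N%:Z - (p - 1) - k%:Z + 1 by lia.
have -> : Q%:Z + 3 * N%:Z - (p - 2) - k%:Z = Q%:Z + 3 * N%:Z - (p - 1) - k%:Z + 1 by lia.
by rewrite !zbinomS !natrD; ring.
Qed.

(** A point on the wall is its own reflection. *)
Lemma refl_paths_wall N k p : 2 * p = Q%:Z + 3 * N%:Z -> refl_paths N k p = 0.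
Proof.
move=> h; rewrite /refl_paths.
have -> : Q%:Z + 3 * N%:Z - p - k%:Z = p - k%:Z by lia.
exact: subrr.
Qed.

Hypothesis Q_gt0 : (0 < Q)%N.

(** At least one forward step is made, so [p] is too low, while its reflection lies beyond the reach
    2 * k. *)
Lemma refl_paths_le0 N k p : p <= 0 -> (0 < k <= N)%N -> refl_paths N k p = 0.
Proof.
move=> p0 kN; rewrite /refl_paths zbinom_neg; last by lia.
by rewrite zbinom_big ?subrr //; lia.
Qed.

Lemma refl_paths0 N p : 2 * p < Q%:Z + 3 * N%:Z -> refl_paths N 0 p = (p == 0)%:R.
Proof.
move=> h; have z0 x : zbinom 0 x = (x == 0) :> nat by case: x => // -[].
rewrite /refl_paths !z0 !subr0.
have -> : (Q%:Z + 3 * N%:Z - p == 0) = false by lia.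
exact: subr0.
Qed.

(** Particle [b] enters at time [b] and has made [N - b] steps at time [N]; row [a] holds the
    shifted end position. [M] is [N], or [N.+1] to include the particle entering at time [N]. *)
Definition path_mx N M (y : nat -> int) : 'M[R]_M :=
  \matrix_(a, b) refl_paths N (N - b) (y a + N%:Z - a%:Z).

(** The condition at [N] says that the particle entering at time [N] stands at 0. *)
Definition config N (y : nat -> int) : bool :=
  [&& y N == 0, [forall a : 'I_N, y a.+1 <= y a] & 2 * y 0%N < Q%:Z + N%:Z].

Lemma config_decr N y : config N y -> forall a b, (a <= b <= N)%N -> y b <= y a.
Proof.
case/and3P=> _ /forallP h _ a b /andP[]; elim: b => [|b IH].
  by rewrite leqn0 => /eqP->.
rewrite leq_eqVlt => /orP[/eqP->//|ab] bN.
by apply: le_trans (IH _ _); [exact: (h (Ordinal bN)) | | exact: ltnW].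
Qed.

(* The configurations that the sum over all steps should not contain give
   a matrix with two equal rows or with a zero row or column. *)
Lemma det_path_mxS N y :
  (forall a, (a < N)%N -> y a.+1 <= y a + 1) -> -1 <= y N -> 2 * y 0%N <= Q%:Z + N%:Z ->
  \det (path_mx N N.+1 y) = if config N y then \det (path_mx N N y) else 0.
Proof.
move=> ystep yN y0.
case: (boolP [forall a : 'I_N, y a.+1 <= y a]) => [decr|]; last first.
  move=> nd; rewrite /config (negPf nd) andbF.
  move: nd; rewrite negb_forall => /existsP[a]; rewrite -ltNge => lt_y.
  have ey : y a.+1 = y a + 1 by have := ystep a (ltn_ord a); lia.
  have neq : widen_ord (leqnSn N) a != lift ord0 a.
    by rewrite -val_eqE /= /bump /=; lia.
  apply: (determinant_alternate neq) => b; rewrite !mxE /=.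
  by congr refl_paths; rewrite /bump /= ey; lia.
case: (ltrP (2 * y 0%N) (Q%:Z + N%:Z)) => [lt_y0|ge_y0]; last first.
  rewrite /config ltNge ge_y0 !andbF; apply: (det_row0 (i := ord0)) => b.
  by rewrite mxE refl_paths_wall //=; lia.
have ydec a b : (a <= b <= N)%N -> y b <= y a.
  case/andP; elim: b => [|b IH]; first by rewrite leqn0 => /eqP->.
  rewrite leq_eqVlt => /orP[/eqP->//|ab] bN.
  apply: le_trans (IH ab (ltnW bN)).
  by have /forallP/(_ (Ordinal bN)) := decr.
rewrite /config decr lt_y0 !andbT.
(* The entering particle has made no step, so its column only detects end positions equal to 0. *)
have lastE (a : 'I_N.+1) : path_mx N N.+1 y a ord_max = (y a + N%:Z - a%:Z == 0)%:R.
  rewrite mxE subnn refl_paths0 //.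
  by have := ydec 0%N a (ltn_ord a); lia.
case: eqP => [yN0|yN0].
  rewrite (expand_det_col _ ord_max) (bigD1 ord_max) //= lastE /= yN0 add0r subrr eqxx mul1r.
  rewrite big1 ?addr0 => [|a neq_a]; last first.
    have aN : (a <= N <= N)%N by rewrite leqnn andbT -ltnS.
    rewrite -val_eqE /= in neq_a; have := ydec _ _ aN; rewrite lastE.
    by case: eqP => [|_]; rewrite ?mul0r //; lia.
  rewrite /cofactor addnn -signr_odd odd_double expr0 mul1r; congr (\det _).
  by apply/matrixP => a b; rewrite !mxE /= /bump (leqNgt N a) (leqNgt N b) !ltn_ord.
(* At position -1 the last row is zero, since no path ends there; at a positive position the last
   column is zero. *)
have [yN1|yN1] := ltrP (y N) 0.
  apply: (det_row0 (i := ord_max)) => b; rewrite mxE /=.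
  have -> : y N + N%:Z - N%:Z = -1 by lia.
  have [bN|bN] := ltnP b N; first by rewrite refl_paths_le0 //; lia.
  have -> : (N - b = 0)%N by lia.
  by rewrite refl_paths0; [have -> : (-1 == 0 :> int) = false by lia | lia].
rewrite -det_tr; apply: (det_row0 (i := ord_max)) => a; rewrite mxE lastE.
have aN : (a <= N <= N)%N by rewrite leqnn andbT -ltnS.
by have := ydec _ _ aN; case: eqP => //; lia.
Qed.

(** The bit [f a] records whether [s a] grew in the last step, i.e. whether particle [a] made a step
    2. Multilinearity in the rows sums over all bits, and [det_path_mxS] discards the forbidden
    ones. *)
Lemma det_path_step N (s : nat -> int) (w : bool -> R) :
  (forall a, (a < N)%N -> s a.+1 <= s a) -> 0 <= s N -> 2 * s 0%N <= Q%:Z + N%:Z ->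
  \det (\matrix_(a < N.+1, b < N.+1)
     (w false * refl_paths N (N - b) (s a + N%:Z - a%:Z) +
      w true * refl_paths N (N - b) (s a + N%:Z - a%:Z - 1))) =
  \sum_(f : {ffun 'I_N.+1 -> bool} | config N (fun a => s a - (f (inord a) : nat)%:Z))
     \prod_a w (f a) * \det (path_mx N N (fun a => s a - (f (inord a) : nat)%:Z)).
Proof.
move=> sdec sN s0.
pose v (x : bool) (a b : 'I_N.+1) := refl_paths N (N - b) (s a - (x : nat)%:Z + N%:Z - a%:Z).
have -> : \matrix_(a < N.+1, b < N.+1)
     (w false * refl_paths N (N - b) (s a + N%:Z - a%:Z) +
      w true * refl_paths N (N - b) (s a + N%:Z - a%:Z - 1)) =
   \matrix_(a < N.+1, b < N.+1) \sum_(x : bool) w x * v x a b.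
  apply/matrixP => a b; rewrite !mxE big_bool addrC /v /=.
  by congr (_ * _ + _ * _); congr refl_paths; lia.
rewrite det_sum_rows [RHS]big_mkcond /=; apply: eq_bigr => f _.
have -> : \matrix_(i, j) v (f i) i j = path_mx N N.+1 (fun a => s a - (f (inord a) : nat)%:Z).
  by apply/matrixP => a b; rewrite !mxE inord_val.
rewrite det_path_mxS => [|a aN| |]; first by case: ifP; rewrite ?mulr0.
- by have := sdec a aN; case: (f _); case: (f _); lia.
- by case: (f _); lia.
by case: (f _); lia.
Qed.

End ReflectedPaths.

(** * Transfer of configurations *)

Lemma big_ffun_recr (R : nmodType) (T : finType) N (F : {ffun 'I_N.+2 -> T} -> R) :
  \sum_S F S =
  \sum_x \sum_(S : {ffun 'I_N.+1 -> T})
     F [ffun i : 'I_N.+2 => if (i < N.+1)%N then S (inord i) else x].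
Proof.
pose h (q : T * {ffun 'I_N.+1 -> T}) : {ffun 'I_N.+2 -> T} :=
  [ffun i : 'I_N.+2 => if (i < N.+1)%N then q.2 (inord i) else q.1].
pose h' (S : {ffun 'I_N.+2 -> T}) :=
  (S ord_max, [ffun i : 'I_N.+1 => S (inord i)]).
rewrite pair_bigA (reindex h) //=; exists h' => [[x S]|S] _.
  congr pair; first by rewrite ffunE ltnn.
  by apply/ffunP => i; rewrite !ffunE inordK ?ltn_ord ?inord_val // ltnW // ltnS.
apply/ffunP => i; rewrite !ffunE /=; case: ltnP => hi.
  by rewrite inordK // inord_val.
by congr (S _); apply: val_inj => /=; have := ltn_ord i; lia.
Qed.

Fixpoint transfer (R : pzSemiRingType) (T : finType) (z : T -> R)
    (W : nat -> T -> T -> R) (N : nat) (x : T) : R :=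
  if N is M.+1 then \sum_y transfer z W M y * W M y x else z x.

(** The end weight [u] is arbitrary so that the induction can absorb the last transition into it. *)
Lemma sum_chains (R : comNzRingType) (T : finType) (z : T -> R)
    (W : nat -> T -> T -> R) N (u : T -> R) :
  \sum_(S : {ffun 'I_N.+1 -> T})
    z (S ord0) * (\prod_(i < N) W i (S (inord i)) (S (inord i.+1))) * u (S ord_max) =
  \sum_x transfer z W N x * u x.
Proof.
elim: N u => [|N IH] u.
  rewrite (reindex (fun x : T => [ffun=> x] : {ffun 'I_1 -> T})) /=.
    by apply: eq_bigr => x _; rewrite big_ord0 mulr1 !ffunE.
  exists (fun S => S ord0) => [x|S] _; first by rewrite ffunE.
  by apply/ffunP => i; rewrite ffunE (ord1 i).
rewrite big_ffun_recr; apply: eq_bigr => x _ /=.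
rewrite -(IH (fun y => W N y x)) big_distrl /=; apply: eq_bigr => S _.
rewrite big_ord_recr /= [finfun _ ord_max]ffunE ltnn !mulrA; congr (_ * _).
rewrite [finfun _ ord0]ffunE /= [finfun _ (inord N)]ffunE [finfun _ (inord N.+1)]ffunE.
rewrite !inordK // ltnSn ltnn.
have -> : (inord 0 : 'I_N.+1) = ord0 by apply: val_inj; rewrite /= inordK.
have -> : (inord N : 'I_N.+1) = ord_max by apply: val_inj; rewrite /= inordK.
congr (_ * _ * _); apply: eq_bigr => i _.
have h1 : (i < N.+1)%N := ltnW (ltn_ord i); have h2 : (i.+1 < N.+1)%N := ltn_ord i.
by rewrite !ffunE !inordK ?h1 ?h2 // ltnW.
Qed.

Section States.
Variable R : comNzRingType.
Variables m K Q : nat.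

Let state := {ffun 'I_m -> 'I_K.+1}.
Implicit Types x y : state.

(** The value 0 outside the range gives the last coordinate a neighbour and avoids bounds on
    indices. *)
Definition at_pos m K (x : {ffun 'I_m -> 'I_K.+1}) (a : nat) : nat :=
  oapp (fun i => x i : nat) 0%N (insub a).

Lemma at_posE x (i : 'I_m) : at_pos x i = x i.
Proof. by rewrite /at_pos valK. Qed.

Lemma at_pos_out x a : (m <= a)%N -> at_pos x a = 0%N.
Proof. by move=> ma; rewrite /at_pos insubF //; lia. Qed.

Lemma at_pos_le x a : (at_pos x a <= K)%N.
Proof.
have [am|ma] := ltnP a m; last by rewrite at_pos_out.
by rewrite -[a]/(val (Ordinal am)) at_posE -ltnS.
Qed.

Lemma state_eqP x y : (forall a, (a < m)%N -> at_pos x a = at_pos y a) -> x = y.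
Proof.
move=> e; apply/ffunP => i; apply: val_inj.
by rewrite /= -!at_posE; apply: e.
Qed.

(** All times share one state type; at time [N] the coordinates of particles that have not yet
    entered are 0. *)
Definition admissible (N : nat) x : bool :=
  [&& [forall a : 'I_m, (N <= a)%N ==> (at_pos x a == 0%N)],
      [forall a : 'I_m, (at_pos x a.+1 <= at_pos x a)%N] &
      (2 * at_pos x 0 < Q + N)%N].

Definition step x y : bool :=
  [forall a : 'I_m, (at_pos x a <= at_pos y a <= (at_pos x a).+1)%N].

Lemma admissibleP N x :
  reflect [/\ forall a, (N <= a)%N -> at_pos x a = 0%N,
              forall a, (at_pos x a.+1 <= at_pos x a)%N &
              (2 * at_pos x 0 < Q + N)%N]
          (admissible N x).
Proof.
apply: (iffP and3P) => [[/forallP h0 /forallP hd h]|[h0 hd h]]; split=> //.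
- move=> a Na; have [am|ma] := ltnP a m; last exact: at_pos_out.
  by have /implyP/(_ Na)/eqP := h0 (Ordinal am).
- move=> a; have [am|ma] := ltnP a m; first exact: (hd (Ordinal am)).
  by rewrite at_pos_out // ltnW.
- by apply/forallP => a; apply/implyP => /h0 ->.
exact/forallP.
Qed.

Lemma stepP x y :
  reflect (forall a, (at_pos x a <= at_pos y a <= (at_pos x a).+1)%N) (step x y).
Proof.
apply: (iffP forallP) => // h a.
have [am|ma] := ltnP a m; first exact: (h (Ordinal am)).
by rewrite !at_pos_out.
Qed.

Definition step_weight (w : bool -> R) N x y : R :=
  \prod_(a < N) w (at_pos x a != at_pos y a).

(** The bits and [y] determine the previous state [x] as their difference, and [x] and [y] determine
    the bits. *)
Lemma sum_configs (w : bool -> R) N y : (N < m)%N -> admissible N.+1 y ->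
  \sum_(f : {ffun 'I_N.+1 -> bool} |
        config Q N (fun a => (at_pos y a)%:Z - (f (inord a) : nat)%:Z))
     \prod_a w (f a) *
     \det (path_mx R Q N N (fun a => (at_pos y a)%:Z - (f (inord a) : nat)%:Z)) =
  \sum_(x | admissible N x && step x y)
     step_weight w N.+1 x y * \det (path_mx R Q N N (fun a => (at_pos x a)%:Z)).
Proof.
move=> Nm /admissibleP[y0 ydec yb].
pose h x : {ffun 'I_N.+1 -> bool} := [ffun a : 'I_N.+1 => at_pos x a != at_pos y a].
(* On configurations the subtraction does not truncate: by [config_decr] all coordinates are at
   least the last one, which is 0. *)
pose h' (f : {ffun 'I_N.+1 -> bool}) : state :=
  [ffun a : 'I_m => inord (at_pos y a - (if (a <= N)%N then f (inord a) else false))].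
have h'E f a : (a < m)%N ->
    at_pos (h' f) a = (at_pos y a - (if (a <= N)%N then f (inord a) else false))%N.
  move=> am; rewrite -[a in LHS]/(val (Ordinal am)) at_posE ffunE inordK //.
  by rewrite ltnS; apply: leq_trans (leq_subr _ _) (at_pos_le _ _).
have hsub x a : admissible N x -> step x y -> (a <= N)%N ->
    (at_pos y a)%:Z - (h x (inord a) : nat)%:Z = (at_pos x a)%:Z.
  move=> _ /stepP/(_ a) sxy aN; rewrite ffunE inordK //.
  by case: eqP => /= e; lia.
rewrite (reindex_onto h h') /=; last first.
  move=> f cf; have cd := config_decr cf; have /and3P[/eqP fN _ _] := cf.
  apply/ffunP => a; rewrite ffunE h'E; last by have := ltn_ord a; lia.
  have aN : (a <= N <= N)%N by rewrite leqnn andbT -ltnS.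
  have := cd _ _ aN; rewrite -ltnS ltn_ord inord_val fN.
  by case: (f a) => /=; case: eqP => //; lia.
apply: eq_big => [x|x /andP[cx /eqP hx]]; last first.
  rewrite /step_weight; congr (_ * _); first by apply: eq_bigr => a _; rewrite ffunE.
  congr (\det _); apply/matrixP => a b; rewrite !mxE; congr (refl_paths _ _ _ _ (_ + _ - _)).
  have aN : (a <= N <= N)%N by rewrite leqnn andbT ltnW.
  have := config_decr cx aN; have /and3P[/eqP -> _ _] := cx => ge0.
  have -> : at_pos x a = at_pos (h' (h x)) a by rewrite hx.
  rewrite h'E; last by have := ltn_ord a; lia.
  by have /andP[-> _] := aN; lia.
apply/andP/andP => [[cx /eqP hx]|[vx sxy]].
  have cd := config_decr cx; have /and3P[/eqP cN _ cb] := cx.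
  have xE a : (a <= N)%N -> (at_pos x a)%:Z = (at_pos y a)%:Z - (h x (inord a) : nat)%:Z.
    move=> aN; have := cd a N; rewrite aN leqnn cN => /(_ isT).
    have -> : at_pos x a = at_pos (h' (h x)) a by rewrite hx.
    by rewrite h'E ?aN; lia.
  have x0 a : (N < a)%N -> at_pos x a = 0%N.
    move=> Na; have [am|ma] := ltnP a m; last exact: at_pos_out.
    by rewrite -hx h'E // y0 // sub0n.
  split.
    apply/admissibleP; split.
    - move=> a; rewrite leq_eqVlt => /orP[/eqP <-|/x0//].
      by have := xE N (leqnn _); rewrite cN; lia.
    - move=> a; have [aN|Na] := ltnP a N; last by rewrite x0.
      by have := cd a a.+1; rewrite leqnSn aN -!xE // ?(ltnW aN) // => /(_ isT); lia.
    by move: cb; rewrite -xE //; lia.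
  apply/stepP => a; have [aN|Na] := leqP a N; last by rewrite x0 // y0.
  by have := xE a aN; case: (h x _) => /=; lia.
have xE a : (a <= N)%N -> _ := hsub x a vx sxy.
have /admissibleP[x0 xdec xb] := vx.
split.
  apply/and3P; split; first by rewrite xE // x0.
    by apply/forallP => a; rewrite !xE ?(ltnW (ltn_ord a)) //; have := xdec a; lia.
  by rewrite xE //; lia.
apply/eqP/state_eqP => a am; rewrite h'E //; case: leqP => [aN|Na].
  by have := xE a aN; lia.
by rewrite x0 ?y0 // ltnW.
Qed.

Hypothesis Q_gt0 : (0 < Q)%N.

Lemma sum_det_step (w : bool -> R) N y : (N < m)%N ->
  \sum_x (admissible N x)%:R * \det (path_mx R Q N N (fun a => (at_pos x a)%:Z)) *
     ((admissible N.+1 y && step x y)%:R * step_weight w N.+1 x y) =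
  (admissible N.+1 y)%:R *
  \det (\matrix_(a < N.+1, b < N.+1)
     (w false * refl_paths R Q N (N - b) ((at_pos y a)%:Z + N%:Z - a%:Z) +
      w true * refl_paths R Q N (N - b) ((at_pos y a)%:Z + N%:Z - a%:Z - 1))).
Proof.
move=> Nm; case: (boolP (admissible N.+1 y)) => /= [ay|_]; last first.
  by rewrite mul0r big1 // => x _; rewrite mul0r mulr0.
have /admissibleP[y0 ydec yb] := ay.
rewrite mul1r (det_path_step (R := R) Q_gt0 w (s := fun a => (at_pos y a)%:Z)); last 3 first.
- by move=> a _; apply: ydec.
- by [].
- by lia.
rewrite sum_configs // [RHS]big_mkcond; apply: eq_bigr => x _ /=.
by case: (admissible N x); case: (step x y); rewrite /= ?mul1r ?mul0r ?mulr0 // mulrC.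
Qed.

Section Transfer.
Variable w : bool -> R.

Definition start x : R := (admissible 0 x)%:R.
(** Only the last transition is weighted, because [tau] compares only the last two antidiagonals. *)
Definition transition i x y : R :=
  (admissible i.+1 y && step x y)%:R * (if i.+1 == m then step_weight w m x y else 1).

(** By [refl_pathsS] the matrix at time [N.+1] has the form required by [sum_det_step] with both
    weights equal to 1. *)
Lemma transfer_path_mx N x : (N < m)%N ->
  transfer start transition N x =
  (admissible N x)%:R * \det (path_mx R Q N N (fun a => (at_pos x a)%:Z)).
Proof.
elim: N x => [|N IH] y Nm /=; first by rewrite det_mx00 mulr1.
have Nm' := ltnW Nm.
have -> : path_mx R Q N.+1 N.+1 (fun a => (at_pos y a)%:Z) =
   \matrix_(a < N.+1, b < N.+1)
     (1 * refl_paths R Q N (N - b) ((at_pos y a)%:Z + N%:Z - a%:Z) +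
      1 * refl_paths R Q N (N - b) ((at_pos y a)%:Z + N%:Z - a%:Z - 1)).
  apply/matrixP => a b; rewrite !mxE !mul1r subSn; last by rewrite -ltnS.
  by rewrite refl_pathsS; congr (_ + _); congr refl_paths; lia.
have /= <- := sum_det_step (fun=> 1) y Nm'; apply: eq_bigr => x _.
rewrite IH // /transition ltn_eqF //; congr (_ * (_ * _)).
by rewrite /step_weight big1.
Qed.

Lemma transfer_last N x : N.+1 = m ->
  transfer start transition N.+1 x =
  (admissible N.+1 x)%:R *
  \det (\matrix_(a < N.+1, b < N.+1)
     (w false * refl_paths R Q N (N - b) ((at_pos x a)%:Z + N%:Z - a%:Z) +
      w true * refl_paths R Q N (N - b) ((at_pos x a)%:Z + N%:Z - a%:Z - 1))).
Proof.
move=> em; have Nm : (N < m)%N by rewrite -em.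
rewrite -sum_det_step //=; apply: eq_bigr => y _.
by rewrite transfer_path_mx // /transition em eqxx.
Qed.

End Transfer.

End States.

(** * Pentagons and chains of configurations *)

Lemma sum_bool_le p (U : nat -> bool) : (\sum_(b < p) U b <= p)%N.
Proof.
rewrite -[leqRHS]card_ord -sum1_card; apply: leq_sum => b _; exact: leq_b1.
Qed.

(** The true values of [U] form an initial segment whose length is the sum; this is the conjugation
    of partitions. *)
Lemma sum_initial p (U : nat -> bool) : (forall a, U a.+1 -> U a) ->
  forall a, (a < p)%N -> (a < \sum_(b < p) U b)%N = U a.
Proof.
move=> Udec; have Ule a b : (a <= b)%N -> U b -> U a.
  move=> ab; rewrite -(subnKC ab); elim: (b - a)%N => [|d IH]; first by rewrite addn0.
  by rewrite addnS => /Udec.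
elim: p => // p IH a; rewrite ltnS => ap; rewrite big_ord_recr /=.
case: (boolP (U p)) => Up.
  rewrite (eq_bigr (fun=> 1%N)) => [|b _]; last by rewrite (Ule _ p) // ltnW.
  by rewrite sum_nat_const card_ord muln1 (Ule _ _ ap Up); lia.
rewrite addn0; move: ap; rewrite leq_eqVlt => /orP[/eqP->|]; last exact: IH.
rewrite (negPf Up); apply/negbTE; rewrite -leqNgt.
exact: sum_bool_le.
Qed.

Lemma sum_ltn_ord p x : (\sum_(b < p) (b < x) = minn p x)%N.
Proof. by elim: p => [|p IH]; rewrite ?big_ord0 ?big_ord_recr /= ?IH; lia. Qed.

Lemma sum_shift_le p (U V : nat -> bool) : (forall a, V a.+1 -> U a) ->
  (\sum_(a < p) V a <= (\sum_(a < p) U a).+1)%N.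
Proof.
move=> VU; case: p => [|p]; first by rewrite !big_ord0.
rewrite big_ord_recl [X in (_ <= X.+1)%N]big_ord_recr /= -add1n.
apply: leq_add; first exact: leq_b1.
apply: leq_trans (leq_addr _ _); apply: leq_sum => a _.
by case: (V _) (VU a) => //= ->.
Qed.

Section MagogEntries.
Variables (n k q b : nat) (P : cell n k q -> nat).
Hypothesis magogP : is_magog b P.

(** If a cell is present, so is its right neighbour, which lies on an earlier diagonal; a cut-off
    left entry counts as 1. *)
Lemma entry_row_le i j : (i < n)%N -> (entry P i j <= entry P i.+1 j)%N.
Proof.
move=> lt_in; case: (boolP (in_pentagon n k q i j)) => [hij|/entry_out->].
  have [c ci cj] := in_cell hij.
  have [|d di dj] := @in_cell n k q i.+1 j; first by move: hij; rewrite /in_pentagon; lia.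
  have /and4P[_ /forallP/(_ c)/forallP/(_ d) + _ _] := magogP.
  by have := entryE P c; have := entryE P d; rewrite ci cj di dj !eqxx => -> ->.
exact: entry_gt0 magogP.
Qed.

(** The cell above a present cell is present, and a cut-off lower entry counts as 1. *)
Lemma entry_col_le i j : (0 < j)%N -> (i < n)%N -> (entry P i.+1 j.+1 <= entry P i j)%N.
Proof.
move=> j0 lt_in; case: (boolP (in_pentagon n k q i.+1 j.+1)) => [hij|/entry_out->].
  have [c ci cj] := in_cell hij.
  have [|d di dj] := @in_cell n k q i j; first by move: hij; rewrite /in_pentagon; lia.
  have /and4P[_ _ /forallP/(_ d)/forallP/(_ c) + _] := magogP.
  by have := entryE P c; have := entryE P d; rewrite ci cj di dj !eqxx => -> ->.
exact: entry_gt0 magogP.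
Qed.

Lemma entry_antitone i j : (0 < j)%N -> (0 < i <= n)%N -> (entry P i j.+1 <= entry P i j)%N.
Proof.
case: i => // i j0 /= lt_in.
exact: leq_trans (entry_col_le j0 lt_in) (entry_row_le j lt_in).
Qed.

Lemma entry_first_le i : (0 < i)%N -> (entry P i 1 <= b + i)%N.
Proof.
move=> i0; case: (boolP (in_pentagon n k q i 1)) => [hij|/entry_out->]; last by lia.
have [c ci cj] := in_cell hij.
have /and4P[_ _ _ /forallP/(_ c)] := magogP.
by have := entryE P c; rewrite ci cj eqxx => ->.
Qed.

Lemma entry_le i j : (0 < j)%N -> (0 < i <= n)%N -> (entry P i j <= b + i)%N.
Proof.
move=> j0 hi; case: j j0 => // j _; elim: j => [|j IH].
  by apply: entry_first_le; lia.
exact: leq_trans (entry_antitone _ hi) IH.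
Qed.

End MagogEntries.

Section Chains.
Variables m k q Q : nat.

(** Here [m] is n - 1: the thresholds v run from 2 to n and the times from 0 to n - 1. *)
Let state := {ffun 'I_m -> 'I_k.+1}.
Let chain := {ffun 'I_m.+1 -> state}.
Let pentagon := {ffun cell m.+1 k q -> 'I_(0 + m.+1).+1}.

Implicit Types (S : chain) (P : pentagon).

Definition is_chain S : bool :=
  admissible Q 0 (S ord0) &&
  [forall i : 'I_m, admissible Q i.+1 (S (inord i.+1)) && step (S (inord i)) (S (inord i.+1))].

Lemma is_chainP S :
  reflect ((forall t, (t <= m)%N -> admissible Q t (S (inord t))) /\
           (forall t, (t < m)%N -> step (S (inord t)) (S (inord t.+1))))
          (is_chain S).
Proof.
have i0 : (inord 0 : 'I_m.+1) = ord0 by apply: val_inj; rewrite /= inordK.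
apply: (iffP andP) => [[h0 /forallP h]|[ha hs]].
  split=> [[|t] tm|t tm]; first by rewrite i0.
    by have /andP[] := h (Ordinal tm).
  by have /andP[] := h (Ordinal tm).
split; first by rewrite -i0 ha.
by apply/forallP => i; rewrite ha // hs.
Qed.

(* In the notation of the header, [at_pos (chain_of P t) a] is s_(a + 2)(t), and
   [pentagon_of] recovers each antidiagonal as a conjugate partition. *)
Definition chain_of P : chain :=
  [ffun t : 'I_m.+1 => [ffun a : 'I_m =>
     inord (\sum_(j < k) (a.+1 < entry (fun c => P c : nat) t.+1 j.+1))]].

Definition height S i j : nat :=
  (\sum_(a < m) (j <= at_pos (S (inord i.-1)) a)%N).+1.

Definition pentagon_of S : pentagon :=
  [ffun c => inord (height S (idx c) (jdx c))].

Lemma height_le S i j : (height S i j <= m.+1)%N.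
Proof.
exact: (sum_bool_le _ (fun a => j <= at_pos (S (inord i.-1)) a)%N).
Qed.

Lemma pentagon_ofE S c : pentagon_of S c = height S (idx c) (jdx c) :> nat.
Proof. by rewrite ffunE inordK // ltnS height_le. Qed.

Lemma chain_ofE P t a : (t <= m)%N -> (a < m)%N ->
  at_pos (chain_of P (inord t)) a =
  (\sum_(j < k) (a.+1 < entry (fun c => P c : nat) t.+1 j.+1))%N.
Proof.
move=> tm am; rewrite -[a in LHS]/(val (Ordinal am)) at_posE !ffunE !inordK //.
rewrite ltnS.
exact: (sum_bool_le _ (fun j => a.+1 < entry (fun c => P c : nat) t.+1 j.+1)%N).
Qed.

Lemma chain_first_le S t : is_chain S -> (t <= m)%N -> (at_pos (S (inord t)) 0 <= t)%N.
Proof.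
case/is_chainP=> ha hs; elim: t => [|t IH] tm.
  by have /admissibleP[h0 _ _] := ha 0%N tm; rewrite h0.
by have /stepP/(_ 0%N) := hs t tm; have := IH (ltnW tm); lia.
Qed.

Lemma at_pos_le_first N (x : state) a : admissible Q N x -> (at_pos x a <= at_pos x 0)%N.
Proof.
by case/admissibleP=> _ dec _; elim: a => // a; apply: leq_trans.
Qed.

(** Rows increase because the s_v never drop, columns decrease because they grow by at most 1, and
    the bound on the first row holds because only [t] coordinates can be nonzero at time [t]. *)
Lemma pentagon_of_magog S : is_chain S -> is_magog 0 (fun c => pentagon_of S c : nat).
Proof.
move=> hS; have /is_chainP[ha hs] := hS.
have cellI (c : cell m.+1 k q) : (0 < jdx c)%N /\ (0 < idx c <= m.+1)%N.
  by have := @cellP _ _ _ c; rewrite /in_pentagon; lia.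
apply/and4P; split; apply/forallP => c; rewrite ?pentagon_ofE //.
- apply/forallP => d; apply/implyP => /andP[/eqP di /eqP dj].
  rewrite !pentagon_ofE di dj ltnS; apply: leq_sum => a _.
  have [_ hc] := cellI c; have [_ hd] := cellI d.
  have tm : ((idx c).-1 < m)%N by lia.
  have /stepP/(_ a) := hs _ tm; rewrite prednK; last by lia.
  by move: (at_pos _ a) (at_pos _ a) => x y; case: leqP; case: leqP; lia.
- apply/forallP => d; apply/implyP => /andP[/eqP di /eqP dj].
  rewrite !pentagon_ofE di dj ltnS; apply: leq_sum => a _.
  have [_ hc] := cellI c; have [_ hd] := cellI d.
  have tm : ((idx c).-1 < m)%N by lia.
  have /stepP/(_ a) := hs _ tm; rewrite prednK; last by lia.
  by move: (at_pos _ a) (at_pos _ a) => x y; case: leqP; case: leqP; lia.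
apply/implyP => /eqP ->; have [_ hc] := cellI c.
have tm : ((idx c).-1 <= m)%N by lia.
have /admissibleP[h0 _ _] := ha _ tm.
apply: (@leq_trans (\sum_(a < m) (a < (idx c).-1)).+1).
  rewrite ltnS; apply: leq_sum => a _; case: (ltnP a (idx c).-1) => [_|/h0->//].
  exact: leq_b1.
by rewrite sum_ltn_ord; lia.
Qed.

Section FromPentagon.
Variable P : pentagon.
Let A i j := entry (fun c => P c : nat) i j.
Hypothesis magogP : is_magog 0 (fun c => P c : nat).

Lemma chain_of_gt t a j : (t <= m)%N -> (a < m)%N -> (j < k)%N ->
  (j < at_pos (chain_of P (inord t)) a)%N = (a.+1 < A t.+1 j.+1)%N.
Proof.
move=> tm am jk; rewrite chain_ofE // (sum_initial (U := fun j => (a.+1 < A t.+1 j.+1)%N)) //.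
by move=> i /leq_trans; apply; apply: (entry_antitone magogP).
Qed.

Lemma chain_ofK : pentagon_of (chain_of P) = P.
Proof.
apply/ffunP => c; apply: val_inj; rewrite /= pentagon_ofE.
have := @cellP _ _ _ c; rewrite /in_pentagon => hc.
have AE : A (idx c) (jdx c) = P c by rewrite /A (entryE (fun c => P c : nat)).
have A0 : (0 < A (idx c) (jdx c))%N by apply: entry_gt0 magogP.
have An := @magog_le _ _ _ _ _ c magogP.
rewrite -AE in An *.
transitivity (\sum_(a < m) (a < (A (idx c) (jdx c)).-1)).+1%N; last first.
  by rewrite sum_ltn_ord; lia.
congr _.+1; apply: eq_bigr => a _; congr nat_of_bool.
case: (jdx c) (idx c) hc => [|j] [|i] hc; try by move: hc => /=; lia.
rewrite /= chain_of_gt; [by lia | by lia | exact: ltn_ord | by lia].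
Qed.

(* The cell (t + 1, j) lies on one of the first [q] diagonals iff 2 j < Q + t. *)
Hypothesis QE : (Q + m.+1 = q + 3)%N.
Hypothesis Q_gt0 : (0 < Q)%N.

Lemma chain_of_is_chain : is_chain (chain_of P).
Proof.
apply/is_chainP; split=> t tm.
  apply/admissibleP; split=> [a ta|a|].
  - have [am|ma] := ltnP a m; last exact: at_pos_out.
    rewrite chain_ofE // big1 // => j _; apply/eqP; rewrite eqb0 -leqNgt.
    by apply: leq_trans (entry_le magogP _ _) _.
  - have [am|ma] := ltnP a.+1 m; last by rewrite at_pos_out.
    rewrite !chain_ofE ?(ltnW am) //; apply: leq_sum => j _.
    by case: (ltnP a.+2) => // /ltnW ->.
  have [m0|m0] := ltnP 0 m; last by rewrite at_pos_out //; lia.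
  (* The last entry counted by s_2 exceeds 1, so its cell is not cut off; its diagonal number then
     gives the wall bound. *)
  case E : (at_pos (chain_of P (inord t)) 0) => [|x]; first by lia.
  have xk : (x < k)%N by rewrite -E at_pos_le.
  have := chain_of_gt tm m0 xk; rewrite E leqnn => /esym.
  case: (boolP (in_pentagon m.+1 k q t.+1 x.+1)) => [|h]; last by rewrite /A entry_out.
  by rewrite /in_pentagon; lia.
apply/stepP => a; have [am|ma] := ltnP a m; last by rewrite !at_pos_out.
have rowE j : (A t.+1 j.+1 <= A t.+2 j.+1)%N by apply: (entry_row_le magogP).
have colE j : (A t.+2 j.+2 <= A t.+1 j.+1)%N by apply: (entry_col_le magogP).
rewrite !chain_ofE ?(ltnW tm) //; apply/andP; split.
  by apply: leq_sum => j _; case: (ltnP a.+1) => // /leq_trans ->.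
apply: (@sum_shift_le _ (fun j => a.+1 < A t.+1 j.+1)%N
  (fun j => a.+1 < A t.+2 j.+1)%N) => j.
by move=> /leq_trans; apply.
Qed.

End FromPentagon.

Hypothesis QE : (Q + m.+1 = q + 3)%N.

(** If the height exceeds 1, then [j] is at most s_2, which is bounded by [k], by the time and by
    the wall; so the cell lies in the pentagon. *)
Lemma height_out S i j : is_chain S -> (0 < j)%N -> (0 < i <= m.+1)%N ->
  ~~ in_pentagon m.+1 k q i j -> height S i j = 1%N.
Proof.
move=> hS j0 hi; apply: contraNeq => hne.
have [a ha] : exists a : 'I_m, (j <= at_pos (S (inord i.-1)) a)%N.
  apply/existsP; apply: contraR hne; rewrite negb_exists => /forallP h.
  by rewrite /height big1 // => a _; rewrite (negPf (h a)).
have im : (i.-1 <= m)%N by lia.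
have /is_chainP[/(_ _ im) hadm _] := hS.
have jle := leq_trans ha (at_pos_le_first a hadm).
have := chain_first_le hS im; have := at_pos_le (S (inord i.-1)) 0.
have /admissibleP[_ _] := hadm; move: jle.
by rewrite /in_pentagon; move: (at_pos _ 0) => x; lia.
Qed.

Lemma entry_pentagon_of S i j : is_chain S -> (0 < j)%N -> (0 < i <= m.+1)%N ->
  entry (fun c => pentagon_of S c : nat) i j = height S i j.
Proof.
move=> hS j0 hi; case: (boolP (in_pentagon m.+1 k q i j)) => h; last first.
  by rewrite entry_out // height_out.
have [c ci cj] := in_cell h.
by rewrite -{1}ci -{1}cj entryE pentagon_ofE ci cj.
Qed.

Lemma pentagon_ofK S : is_chain S -> chain_of (pentagon_of S) = S.
Proof.
move=> hS; have /is_chainP[ha hs] := hS.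
apply/ffunP => t; have tm : (t <= m)%N by rewrite -ltnS.
rewrite -[t]inord_val; apply: state_eqP => a am; rewrite chain_ofE //.
have /admissibleP[_ dec _] := ha _ tm.
transitivity (\sum_(j < k) (j < at_pos (S (inord t)) a))%N; last first.
  by rewrite sum_ltn_ord; apply/minn_idPr/at_pos_le.
apply: eq_bigr => j _; rewrite entry_pentagon_of // /height ltnS /=.
rewrite (sum_initial (U := fun a => (j < at_pos (S (inord t)) a)%N)) // => b.
by move=> /leq_trans; apply.
Qed.

(** The entries with fixed first index sum to [k] plus the sum of the s_v, so [tau] is n minus the
    number of s_v growing in the last step; n = m + 1 leaves the extra 1. *)
Lemma tau_pentagon_of S : is_chain S -> (0 < m)%N ->
  tau (fun c => pentagon_of S c : nat) =
  (\sum_(a < m) (at_pos (S (inord m.-1)) a == at_pos (S (inord m)) a)).+1%N.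
Proof.
move=> hS m0; have /is_chainP[_ /(_ m.-1)] := hS.
rewrite prednK // leqnn => /(_ isT) /stepP hst.
have colsum t : (\sum_(1 <= i < k.+1) (height S t i)%:Z =
    k%:Z + \sum_(a < m) (at_pos (S (inord t.-1)) a)%:Z)%R.
  rewrite big_add1 /= big_mkord /height.
  rewrite (eq_bigr _ (fun i _ => intS _)) big_split /= sumr_const card_ord natz; congr (_ + _).
  rewrite -!(big_morph Posz PoszD (erefl _)) exchange_big; congr Posz.
  apply: eq_bigr => a _ /=; rewrite sum_ltn_ord.
  exact/minn_idPr/at_pos_le.
rewrite /tau sumrB.
rewrite (eq_big_nat _ _ (F2 := fun i => (height S m i)%:Z)); last first.
  by move=> i /andP[i0 _]; rewrite entry_pentagon_of //=; lia.
rewrite [X in _ + (_ - X)](eq_big_nat _ _ (F2 := fun i => (height S m.+1 i)%:Z)); last first.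
  by move=> i /andP[i0 _]; rewrite entry_pentagon_of //=; lia.
rewrite !colsum /= opprD addrACA subrr add0r -sumrB.
rewrite !intS -addrA; congr (1 + _).
transitivity (\sum_(a < m) (1 + ((at_pos (S (inord m.-1)) a)%:Z - (at_pos (S (inord m)) a)%:Z))).
  by rewrite [RHS]big_split /= sumr_const card_ord natz.
rewrite (big_morph Posz PoszD (erefl _)).
apply: eq_bigr => a _; have := hst a.
by case: eqP => /=; lia.
Qed.

End Chains.

(** * The generating function *)

Lemma det_rev (R : comNzRingType) m (M : 'M[R]_m) :
  \det (\matrix_(i, j) M (rev_ord i) (rev_ord j)) = \det M.
Proof.
pose s := perm (@rev_ord_inj m).
have -> : \matrix_(i, j) M (rev_ord i) (rev_ord j) = row_perm s (col_perm s M).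
  by apply/matrixP => i j; rewrite !mxE !permE.
rewrite row_permE col_permE !det_mulmx !det_perm odd_permV mulrCA -exprD addnn.
by rewrite -signr_odd odd_double mulr1.
Qed.

Lemma sincr_gap m p (f : {ffun 'I_m -> 'I_p}) (i j : 'I_m) :
  sincr f -> (i <= j)%N -> (f i + (j - i) <= f j)%N.
Proof.
move=> /sincrP hf; case: j => j; elim: j => [|j IH] jm /=.
  rewrite leqn0 => /eqP i0; rewrite sub0n addn0; apply: eq_leq.
  by congr (nat_of_ord (f _)); apply: val_inj.
rewrite leq_eqVlt => /orP[/eqP e|ij].
  rewrite e subnn addn0; apply: eq_leq.
  by congr (nat_of_ord (f _)); apply: val_inj.
have := IH (ltnW jm) ij; have := hf (Ordinal (ltnW jm)) (Ordinal jm) (ltnSn _).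
by rewrite /=; lia.
Qed.

(** Adding a staircase turns weakly decreasing states in an m by K box into strict sequences. The
    bound on [2 * K] places the whole box below the wall. *)
Lemma sum_admissible (R : comNzRingType) m K Q p (G : int -> nat -> R) :
  (0 < m)%N -> (K + m = p.+1)%N -> (2 * K < Q + m)%N ->
  \sum_(x : {ffun 'I_m -> 'I_K.+1} | admissible Q m x)
     \det (\matrix_(a < m, b < m) G ((at_pos x a)%:Z + m%:Z - a%:Z) (m - b)%N) =
  \sum_(f : {ffun 'I_m -> 'I_p.+1} | sincr f)
     \det (\matrix_(i < m, j < m) G (f i).+1%:Z j.+1).
Proof.
move=> m0 Kmp KQ.
pose h (f : {ffun 'I_m -> 'I_p.+1}) : {ffun 'I_m -> 'I_K.+1} :=
  [ffun a => inord (f (rev_ord a) - rev_ord a)].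
pose h' (x : {ffun 'I_m -> 'I_K.+1}) : {ffun 'I_m -> 'I_p.+1} :=
  [ffun i => inord (x (rev_ord i) + i)].
have h'E x i : h' x i = (x (rev_ord i) + i)%N :> nat.
  rewrite ffunE inordK //; have := ltn_ord (x (rev_ord i)); have := ltn_ord i; lia.
pose i0 : 'I_m := Ordinal m0; pose im := rev_ord i0.
have ge_f (f : {ffun 'I_m -> 'I_p.+1}) (i : 'I_m) : sincr f -> (i <= f i <= K + i)%N.
  move=> hf; have := sincr_gap (i := i0) (j := i) hf (leq0n _).
  have ile : (i <= im)%N by rewrite /=; have := ltn_ord i; lia.
  have := sincr_gap hf ile; have := ltn_ord (f im); have := ltn_ord i.
  by move: ile => /=; lia.
have hE (f : {ffun 'I_m -> 'I_p.+1}) a : sincr f -> h f a = (f (rev_ord a) - rev_ord a)%N :> nat.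
  by move=> hf; rewrite ffunE inordK //; have := ge_f f (rev_ord a) hf; lia.
rewrite (reindex_onto h h') /=; last first.
  move=> x ax; apply/ffunP => a; apply: val_inj.
  rewrite /h ffunE /= h'E rev_ordK addnK inordK //.
have sadm (f : {ffun 'I_m -> 'I_p.+1}) : sincr f -> admissible Q m (h f).
  move=> hf; apply/admissibleP; split=> [a|a|]; first exact: at_pos_out.
    have [am|ma] := ltnP a.+1 m; last by rewrite at_pos_out.
    rewrite -[a.+1]/(val (Ordinal am)) -[a in leqRHS]/(val (Ordinal (ltnW am))).
    rewrite !at_posE !hE //.
    set i := rev_ord _; set j := rev_ord _.
    have ij : (i <= j)%N by rewrite /=; lia.
    have := sincr_gap hf ij; have := ge_f f i hf; have := ge_f f j hf.
    by move: ij; move: (nat_of_ord i) (nat_of_ord j); lia.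
  by have := at_pos_le (h f) 0; lia.
apply: eq_big => [f|f /andP[_ /eqP hf]].
  apply/andP/idP => [[ax /eqP <-]|hf].
    apply/sincrP => i j ij; rewrite !h'E.
    suff : (h f (rev_ord i) <= h f (rev_ord j))%N by lia.
    have /admissibleP[_ dec _] := ax.
    have mono a b : (a <= b)%N -> (at_pos (h f) b <= at_pos (h f) a)%N.
      move=> ab; rewrite -(subnKC ab); elim: (b - a)%N => [|d IH]; first by rewrite addn0.
      by rewrite addnS; apply: leq_trans (dec _) IH.
    by rewrite -!at_posE; apply: mono => /=; lia.
  split; first exact: sadm.
  apply/eqP/ffunP => i; apply: val_inj; rewrite /= h'E hE // rev_ordK.
  by have := ge_f f i hf; lia.
(* States decrease while [f] increases, so rows and columns are both reversed. *)
rewrite -det_rev; congr (\det _); apply/matrixP => i j; rewrite !mxE at_posE.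
rewrite -[in RHS]hf h'E; have := ltn_ord i; have := ltn_ord j => jm im'.
by congr G => /=; lia.
Qed.

(** The last step to position [e] is 1 with weight t, the number staying constant, or 2 with weight
    1. *)
Lemma bcoef_refl_paths n l r N Q (e : int) k :
  n = N.+2 -> Q%:Z = r%:Z - l%:Z - n%:Z + 3 ->
  bcoef n l r e k.+1 =
  'X * refl_paths {poly rat} Q N k (e - 1) + 1 * refl_paths {poly rat} Q N k (e - 1 - 1).
Proof.
move=> -> QE; rewrite /bcoef /refl_paths /=.
have -> : e - k.+1%:Z = e - 1 - k%:Z by lia.
have -> : e - 1 - k.+1%:Z = e - 1 - 1 - k%:Z by lia.
have -> : r%:Z - e - l%:Z + 2 * N.+2%:Z - 1 - k.+1%:Z = Q%:Z + 3 * N%:Z - (e - 1) - k%:Z by lia.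
have -> : r%:Z - e - l%:Z + 2 * N.+2%:Z - k.+1%:Z = Q%:Z + 3 * N%:Z - (e - 1 - 1) - k%:Z by lia.
by ring.
Qed.

Definition last_weight (b : bool) : {poly rat} := if b then 1 else 'X.

(** Pentagons are exchanged for chains; the extra 1 in [tau] is the factor ['X] in front, and the
    rest of the exponent is the weight of the last step. *)
Lemma GF_transfer N k q Q : (Q + N.+2 = q + 3)%N -> (0 < Q)%N ->
  GF 0 N.+2 k q =
  'X * \sum_(x : {ffun 'I_N.+1 -> 'I_k.+1})
         transfer (start _ Q) (transition Q last_weight) N.+1 x.
Proof.
move=> QE Q0; rewrite /GF.
rewrite (reindex_onto (@pentagon_of N.+1 k q) (@chain_of N.+1 k q)) /=; last first.
  by move=> P; apply: chain_ofK.
rewrite [in RHS](eq_bigr (fun x => transfer (start _ Q) (transition Q last_weight) N.+1 x * 1));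
  last by move=> x _; rewrite mulr1.
have := sum_chains (start {poly rat} Q) (transition Q last_weight) N.+1 (fun=> 1).
move=> /= <-; rewrite big_distrr big_mkcond; apply: eq_bigr => S _ /=.
have -> : is_magog 0 (fun c => pentagon_of q S c : nat) && (chain_of (pentagon_of q S) == S) =
    is_chain Q S.
  apply/andP/idP => [[magogS /eqP <-]|hS].
    exact: (chain_of_is_chain magogS QE).
  by rewrite (pentagon_ofK QE hS) eqxx; split=> //; apply: pentagon_of_magog hS.
rewrite mulr1 /start /transition big_split /= -natr_prod.
have -> : \prod_(i < N.+1) (if i.+1 == N.+1 then
     step_weight last_weight N.+1 (S (inord i)) (S (inord i.+1)) else 1) =
   step_weight last_weight N.+1 (S (inord N)) (S (inord N.+1)).
  rewrite big_ord_recr /= eqxx big1 ?mul1r // => i _.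
  by rewrite ltn_eqF // ltnS ltn_ord.
have -> : (admissible Q 0 (S ord0))%:R *
   ((\prod_(i < N.+1) (admissible Q i.+1 (S (inord i.+1)) && step (S (inord i)) (S (inord i.+1))))%:R
     * step_weight last_weight N.+1 (S (inord N)) (S (inord N.+1))) =
   (is_chain Q S)%:R * step_weight last_weight N.+1 (S (inord N)) (S (inord N.+1)) :> {poly rat}.
  rewrite mulrA -natrM /is_chain; congr (_%:R * _); case: (admissible Q 0 _); rewrite ?mul0n //.
  rewrite mul1n /=; case: forallP => [h|/forallP h].
    by rewrite big1 // => i _; rewrite h.
  by move: h; rewrite negb_forall => /existsP[i /negPf hi]; rewrite (bigD1 i) //= hi mul0n.
case: ifP => [hS|_]; last by rewrite mul0r mulr0.
rewrite mul1r (tau_pentagon_of QE hS) // exprSz /step_weight; congr (_ * _).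
transitivity (\prod_(a < N.+1)
  'X ^+ (at_pos (S (inord N)) a == at_pos (S (inord N.+1)) a) : {poly rat}).
  exact: (big_morph (fun e => 'X ^+ e) (fun a b => exprD _ a b) (expr0 _)).
by apply: eq_bigr => a _; rewrite /last_weight; case: eqP.
Qed.

Lemma GF_sum_minors N l r (n := N.+2) :
  n%:Z - 2 < r%:Z -> l%:Z + r%:Z < 2 * n%:Z - 2 -> r%:Z - l%:Z > n%:Z - 3 ->
  GF 0 n (r + 2 - n) (r - l) =
  'X * \sum_(f : {ffun 'I_N.+1 -> 'I_r.+1} | sincr f)
    \det (\matrix_(i < N.+1, j < N.+1) bcoef n l r (f i).+1%:Z j.+1).
Proof.
rewrite /n => hnr hlr hrl; pose Q := (r - l + 3 - N.+2)%N.
have QE : (Q + N.+2 = r - l + 3)%N by rewrite /Q; lia.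
have Q0 : (0 < Q)%N by rewrite /Q; lia.
have QZ : Q%:Z = r%:Z - l%:Z - N.+2%:Z + 3 by rewrite /Q; lia.
rewrite (GF_transfer (r + 2 - N.+2) QE Q0); congr (_ * _).
(* With K = r + 2 - n and m = n - 1 one has K + m = r + 1, and l + r < 2n - 2 is exactly 2K < Q +
   m. *)
rewrite -(@sum_admissible _ _ (r + 2 - N.+2) Q) //; [|lia|lia].
rewrite [RHS]big_mkcond; apply: eq_bigr => x _.
rewrite (transfer_last Q0 last_weight x (erefl _)).
case: (admissible _ _ _); last exact: mul0r.
rewrite mul1r; congr (\det _); apply/matrixP => a b; rewrite !mxE.
rewrite subSn; last by rewrite -ltnS.
rewrite (bcoef_refl_paths _ _ (erefl _) QZ).
by congr (_ * _ + _ * _); congr refl_paths; lia.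
Qed.

Lemma unit_polyQ_nat k : (0 < k)%N -> (k%:R : {poly rat}) \is a GRing.unit.
Proof.
move=> k0; rewrite -polyC_natr poly_unitE size_polyC.
have k1 : (k%:R : rat) != 0 by rewrite pnatr_eq0 -lt0n.
by rewrite k1 coefC eqxx unitfE.
Qed.

Lemma AmxE n l r (i j : 'I_n.-1) :
  Amx n l r i j = minor_pair (fun e : 'I_r.+1 => fun k => bcoef n l r e.+1%:Z k.+1) i j.
Proof.
rewrite mxE /minor_pair big_add1 /= big_mkord; apply: eq_bigr => e _.
rewrite big_add1 /=.
rewrite (@big_nat_widenl _ _ _ _ 0) // big_mkord; apply: eq_bigr => f _.
by rewrite (expand_det_row _ ord0) !big_ord_recl big_ord0 /cofactor !det_mx11 !mxE /=;
  rewrite !(tnth_nth 0%N) /=; ring.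
Qed.

Theorem theorem2p8 (n l r : nat)
  (hl : l%:Z <= n%:Z - 2) (hnr : n%:Z - 2 < r%:Z) (hr : r%:Z <= 2 * n%:Z - 3)
  (hlr : l%:Z + r%:Z < 2 * n%:Z - 2) (hrl : r%:Z - l%:Z > n%:Z - 3) :
  (odd n -> GF 0 n (r + 2 - n) (r - l) = 'X * Pf (Amx n l r)) /\
  (~~ odd n -> GF 0 n (r + 2 - n) (r - l) = 'X * Pf (Astar n l r)).
Proof.
(* The bound [hl] forces n >= 2. *)
case: n hl hnr hr hlr hrl => [|[|N]] hl hnr hr hlr hrl; [lia|lia|].
have u k : (2 ^ k * k`!)%N%:R \is a @GRing.unit {poly rat}.
  by apply: unit_polyQ_nat; rewrite muln_gt0 expn_gt0 fact_gt0.
rewrite GF_sum_minors //; split=> /= pn; congr (_ * _).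
  rewrite (@Pf_minor _ _ _ (fun e : 'I_r.+1 => fun k => bcoef N.+2 l r e.+1%:Z k.+1)) //.
    exact: (@AmxE N.+2).
(* For even n the matrix [Amx] has odd order n - 1, hence the border. *)
symmetry; apply: (@Pf_minor_border _ _ _ (fun e k => bcoef N.+2 l r e.+1%:Z k.+1)) => //.
- by move: pn; rewrite negbK.
- exact: (@AmxE N.+2).
by move=> i; rewrite mxE big_add1 /= big_mkord.
Qed.
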